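(* Let $n\ge 6$ with $n\equiv 2 \pmod 4$. Let $c_i$ be the $i$-th column of the cyclic matrix $C$, and for $q>0$ let $C^q$ be the $2\times n$ matrix with columns $c_i^q=q^{(-1)^i}c_i$, $i=1,\dots,n$. Then: (1) $C^1=C$; (2) the row spans $[C^q]$, $q>0$, are pairwise distinct points of $Gr^{>0}(2,n)$; (3) there is a neighborhood $U$ of $1$ such that $E(C^q)=E(C)$ for all $q\in U$, $q>0$. In particular, the minimizer of $E$ on $Gr^{>0}(2,n)$ is not unique.
   Context: For a real $2\times n$ matrix $X$ and $1\le i<j\le n$, $\Delta_{i,j}(X)$ is the determinant of the $2\times2$ submatrix of columns $i,j$. $Gr^{>0}(2,n)$ is the set of 2-dimensional subspaces of $\mathbb{R}^n$ having a spanning $2\times n$ matrix $X$ (rows spanning the subspace) with $\Delta_{i,j}(X)>0$ for all $i<j$; $E(X)=E([X])=\max_{i<j}\Delta_{i,j}(X)/\min_{i<j}\Delta_{i,j}(X)$. The cyclic matrix $C$ is the $2\times n$ matrix whose $m$-th column is $(\cos((m-1)\pi/n),\sin((m-1)\pi/n))^T$, $m=1,\dots,n$. *)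

(* Defs.v *)
From Stdlib Require Import Reals Lra Lia List.
Open Scope R_scope.

(* A real 2 x n matrix is represented by its columns, indexed 1..n
   (values at other indices are irrelevant). Column m = (row1 entry, row2 entry). *)
Definition mat2 := nat -> (R * R).

Definition Delta (X : mat2) (i j : nat) : R :=
  fst (X i) * snd (X j) - snd (X i) * fst (X j).

Definition pairs (n : nat) : list (nat * nat) :=
  flat_map (fun i => map (fun j => (i, j)) (seq (S i) (n - i))) (seq 1 n).

Definition maxDelta (n : nat) (X : mat2) : R :=
  fold_right (fun p acc => Rmax (Delta X (fst p) (snd p)) acc) (Delta X 1 2) (pairs n).
Definition minDelta (n : nat) (X : mat2) : R :=
  fold_right (fun p acc => Rmin (Delta X (fst p) (snd p)) acc) (Delta X 1 2) (pairs n).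

Definition E (n : nat) (X : mat2) : R := maxDelta n X / minDelta n X.

Definition rowspan (n : nat) (X : mat2) (v : nat -> R) : Prop :=
  exists a b : R, forall m, (1 <= m <= n)%nat ->
    v m = a * fst (X m) + b * snd (X m).

Definition same_space (S T : (nat -> R) -> Prop) : Prop := forall v, S v <-> T v.

Definition InGrPos (n : nat) (S : (nat -> R) -> Prop) : Prop :=
  exists X : mat2, same_space S (rowspan n X) /\
    forall i j, (1 <= i)%nat -> (i < j)%nat -> (j <= n)%nat -> Delta X i j > 0.

Definition Cyc (n : nat) : mat2 :=
  fun m => (cos (INR (m - 1) * PI / INR n), sin (INR (m - 1) * PI / INR n)).

Definition Cq (n : nat) (q : R) : mat2 :=
  fun i => let s := if Nat.even i then q else / q in
           (s * fst (Cyc n i), s * snd (Cyc n i)).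

(* Main.v *)
Require Import Defs.
From Stdlib Require Import Reals.
From Stdlib Require Import Lra Lia List FunctionalExtensionality.
Open Scope R_scope.

(* Write u = pi/n and c = cos u.  Column i of C^q is
   sg q i * (cos((i-1)u), sin((i-1)u)) with sg q i = q^{(-1)^i}, so every
   Plücker coordinate factors as Delta_{ij}(C^q) = sg q i * sg q j * sin((j-i)u).
   (1) C^1 = C is immediate.
   (2) All these coordinates are positive, so [C^q] lies in Gr^{>0}(2,n); and
       comparing the first row of C^q with the row span of C^{q'} on columns
       1, 2, 3 forces q = q'.
   (3) For n = 4t+2 two columns of equal parity are an even distance apart,
       hence never at distance n/2 = 2t+1 where sin attains 1; their sine lies
       in [sin 2u, cos u] and their scale factor q^{+-2} lies in the window
       [c, 1/c].  Whenever q^2 is in that window (true for q near 1) every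
       coordinate of C^q lies in [sin u, 1], the value 1 being attained at
       distance n/2 between columns of opposite parity and sin u at adjacent
       columns.  Hence E(C^q) = 1/sin u = E(C) for all such q. *)

Definition sg (q : R) (i : nat) : R := if Nat.even i then q else / q.

Lemma sg_pos q i : 0 < q -> 0 < sg q i.
Proof.
  intros Hq. unfold sg.
  destruct (Nat.even i); [exact Hq | apply Rinv_0_lt_compat, Hq].
Qed.

Lemma sg_opposite_parity q i j :
  q <> 0 -> Nat.even i <> Nat.even j -> sg q i * sg q j = 1.
Proof.
  intros Hq Hij. unfold sg.
  destruct (Nat.even i), (Nat.even j); try congruence; field; exact Hq.
Qed.

Lemma Cq_1 n : Cq n 1 = Cyc n.
Proof.
  apply functional_extensionality. intros i. unfold Cq.
  destruct (Cyc n i) as [a b]. cbn [fst snd].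
  destruct (Nat.even i); rewrite ?Rinv_1, !Rmult_1_l; reflexivity.
Qed.

Lemma Cq_col n q m : Cq n q m =
  (sg q m * cos (INR (m - 1) * (PI / INR n)),
   sg q m * sin (INR (m - 1) * (PI / INR n))).
Proof.
  unfold Cq, Cyc, sg. cbn [fst snd].
  replace (INR (m - 1) * PI / INR n) with (INR (m - 1) * (PI / INR n))
    by (unfold Rdiv; ring).
  reflexivity.
Qed.

Lemma Delta_Cq n q i j : (1 <= i)%nat -> (i < j)%nat ->
  Defs.Delta (Cq n q) i j = (sg q i * sg q j) * sin (INR (j - i) * (PI / INR n)).
Proof.
  intros Hi Hij.
  assert (Hangle : INR (j - i) * (PI / INR n) =
     INR (j - 1) * PI / INR n - INR (i - 1) * PI / INR n).
  { rewrite !minus_INR by lia. unfold Rdiv. ring. }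
  rewrite Hangle, sin_minus. unfold Defs.Delta, Cq, Cyc, sg; simpl.
  destruct (Nat.even i), (Nat.even j); ring.
Qed.

Section SineOnGrid.
Variables (n : nat) (u : R).
Hypotheses (Hu : 0 < u) (Hnu : INR n * u = PI).

Lemma sin_grid_pos k : (1 <= k < n)%nat -> 0 < sin (INR k * u).
Proof.
  intros Hk.
  assert (H1 : 1 <= INR k) by (apply (le_INR 1); lia).
  assert (H2 : INR k < INR n) by (apply lt_INR; lia).
  apply sin_gt_0; nra.
Qed.

Lemma sin_grid_sym k : (k <= n)%nat -> sin (INR (n - k) * u) = sin (INR k * u).
Proof.
  intros Hk. rewrite minus_INR by exact Hk.
  replace ((INR n - INR k) * u) with (PI - INR k * u) by (rewrite <- Hnu; ring).
  apply sin_PI_x.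
Qed.

Lemma sin_grid_mono a b : (a <= b)%nat -> (2 * b <= n)%nat ->
  sin (INR a * u) <= sin (INR b * u).
Proof.
  intros Hab Hb.
  assert (H2 : INR (2 * b) <= INR n) by (apply le_INR; exact Hb).
  rewrite mult_INR in H2. replace (INR 2) with 2 in H2 by (simpl; ring).
  assert (Ha : INR a <= INR b) by (apply le_INR; exact Hab).
  pose proof (pos_INR a). pose proof PI_RGT_0.
  apply sin_incr_1; nra.
Qed.

Lemma sin_grid_lower a k : (a <= k)%nat -> (k <= n - a)%nat -> (2 * a <= n)%nat ->
  sin (INR a * u) <= sin (INR k * u).
Proof.
  intros Hak Hkn Ha.
  destruct (Compare_dec.le_lt_dec (2 * k) n) as [Hk | Hk].
  - apply sin_grid_mono; assumption.
  - rewrite <- (sin_grid_sym k) by lia. apply sin_grid_mono; lia.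
Qed.

(* Off the middle grid point pi/2, the sine is at most sin(pi/2 - u) = cos u. *)
Lemma sin_grid_upper h k : n = (2 * h)%nat -> (1 <= h)%nat -> (k <= n)%nat -> k <> h ->
  sin (INR k * u) <= cos u.
Proof.
  intros Hn Hh Hk Hkh.
  assert (Hcos : sin (INR (h - 1) * u) = cos u).
  { rewrite <- sin_shift. f_equal. rewrite minus_INR by exact Hh.
    rewrite <- Hnu, Hn, mult_INR. simpl INR. lra. }
  rewrite <- Hcos.
  destruct (Compare_dec.le_lt_dec k (h - 1)) as [Hk' | Hk'].
  - apply sin_grid_mono; lia.
  - rewrite <- (sin_grid_sym k) by exact Hk. apply sin_grid_mono; lia.
Qed.

End SineOnGrid.

Lemma grid_step n : (1 <= n)%nat -> 0 < PI / INR n /\ INR n * (PI / INR n) = PI.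
Proof.
  intros Hn.
  assert (HN : 0 < INR n) by (apply lt_0_INR; lia).
  pose proof PI_RGT_0.
  split; [apply Rdiv_lt_0_compat; lra | field; lra].
Qed.

Lemma step_trig_bounds n : (6 <= n)%nat ->
  0 < sin (PI / INR n) /\ 0 < cos (PI / INR n) < 1 /\
  1/2 <= cos (PI / INR n) * cos (PI / INR n).
Proof.
  intros Hn. destruct (grid_step n) as [Hu Hnu]; [lia|].
  set (u := PI / INR n) in *.
  assert (HN : 6 <= INR n)
    by (replace 6 with (INR 6) by (simpl; ring); apply le_INR; exact Hn).
  pose proof PI_RGT_0.
  assert (Hs : 0 < sin u) by (apply sin_gt_0; nra).
  assert (Hs2 : sin u <= 1/2) by (rewrite <- sin_PI6; apply sin_incr_1; nra).
  assert (Hc : 0 < cos u) by (apply cos_gt_0; nra).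
  pose proof (sin2_cos2 u). unfold Rsqr in *.
  repeat split; nra.
Qed.

Definition in_window (c s : R) : Prop := c <= s /\ s * c <= 1.

Lemma in_window_inv c s : 0 < c -> 0 < s -> in_window c s -> in_window c (/ s).
Proof.
  intros Hc Hs [H1 H2].
  assert (Hinv : s * / s = 1) by (field; lra).
  assert (0 < / s) by (apply Rinv_0_lt_compat, Hs).
  split; nra.
Qed.

(* Columns of equal parity carry the factor q^2 or q^{-2}, both in the window with q^2. *)
Lemma sg_same_parity c q i j : 0 < c -> 0 < q -> Nat.even i = Nat.even j ->
  in_window c (q * q) -> in_window c (sg q i * sg q j).
Proof.
  intros Hc Hq Hij Hw. unfold sg. rewrite Hij.
  destruct (Nat.even j); [exact Hw|].
  rewrite <- Rinv_mult. apply in_window_inv; [exact Hc | nra | exact Hw].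
Qed.

Lemma in_window_near_one c q : 0 < c < 1 -> Rabs (q - 1) < (1 - c) / 2 ->
  in_window c (q * q).
Proof.
  intros Hc Hq. apply Rabs_def2 in Hq as [Hq1 Hq2].
  assert (Hlow : c <= (1 + c) / 2 * ((1 + c) / 2)) by nra.
  assert (Hup : (3 - c) / 2 * ((3 - c) / 2) * c <= 1).
  { assert (0 <= (1 - c) * (1 - c) * (4 - c)) by (apply Rmult_le_pos; nra). nra. }
  split; nra.
Qed.

(* If s is in the window of c and sin 2u = 2 y c <= x <= c, then y <= s x <= 1. *)
Lemma window_product_bounds c s x y : 0 < y -> 0 < c -> 1/2 <= c * c ->
  in_window c s -> 2 * y * c <= x <= c -> y <= s * x <= 1.
Proof.
  intros Hy Hc Hcc [Hs1 Hs2] [Hx1 Hx2].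
  assert (Hx : 0 < x) by nra.
  assert (Hlow : c * (2 * y * c) <= s * x) by nra.
  assert (Hup : s * x <= s * c) by nra.
  split; nra.
Qed.

Lemma same_parity_distance i j : (i < j)%nat -> Nat.even i = Nat.even j ->
  exists m, (j - i = 2 * m /\ 1 <= m)%nat.
Proof.
  intros Hij Hpar.
  assert (Hev : Nat.even (j - i) = true)
    by (rewrite Nat.even_sub by lia; rewrite Hpar; apply Bool.eqb_reflx).
  apply Nat.even_spec in Hev as [m Hm]. exists m. lia.
Qed.

Lemma Delta_Cq_bounds n t q i j : n = (4 * t + 2)%nat -> (1 <= t)%nat -> 0 < q ->
  in_window (cos (PI / INR n)) (q * q) ->
  (1 <= i)%nat -> (i < j)%nat -> (j <= n)%nat ->
  sin (PI / INR n) <= Defs.Delta (Cq n q) i j <= 1.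
Proof.
  intros Hn Ht Hq Hw Hi Hij Hj.
  destruct (grid_step n) as [Hu Hnu]; [lia|].
  destruct (step_trig_bounds n) as (Hs & [Hc _] & Hcc); [lia|].
  set (u := PI / INR n) in *.
  rewrite Delta_Cq by assumption. fold u.
  destruct (Bool.bool_dec (Nat.even i) (Nat.even j)) as [Hpar | Hpar].
  - destruct (same_parity_distance i j Hij Hpar) as (m & Hm & Hm1).
    apply window_product_bounds with (c := cos u); try assumption.
    + apply sg_same_parity; assumption.
    + split.
      * rewrite <- sin_2a.
        replace (2 * u) with (INR 2 * u) by (simpl; ring).
        apply (sin_grid_lower n); try assumption; lia.
      * apply (sin_grid_upper n u Hu Hnu (2 * t + 1)); lia.
  - rewrite sg_opposite_parity by (exact Hpar || apply Rgt_not_eq, Hq).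
    rewrite Rmult_1_l.
    split; [|apply SIN_bound].
    replace u with (INR 1 * u) at 1 by (simpl; ring).
    apply (sin_grid_lower n); try assumption; lia.
Qed.

Lemma in_pairs n i j : In (i, j) (pairs n) <-> (1 <= i /\ i < j /\ j <= n)%nat.
Proof.
  unfold pairs. rewrite in_flat_map. split.
  - intros [i' [Hi' Hin]]. rewrite in_map_iff in Hin.
    destruct Hin as [j' [Heq Hj']]. inversion Heq; subst.
    rewrite in_seq in Hi', Hj'. lia.
  - intros H. exists i. split; [rewrite in_seq; lia|].
    rewrite in_map_iff. exists j. split; [reflexivity | rewrite in_seq; lia].
Qed.

Lemma fold_max_le (f : nat * nat -> R) l init M :
  (forall p, In p l -> f p <= M) -> init <= M ->
  fold_right (fun p acc => Rmax (f p) acc) init l <= M.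
Proof.
  induction l as [|a l IH]; simpl; intros H Hinit; [exact Hinit|].
  apply Rmax_lub; auto.
Qed.

Lemma fold_max_ge (f : nat * nat -> R) l init p :
  In p l -> f p <= fold_right (fun p acc => Rmax (f p) acc) init l.
Proof.
  induction l as [|a l IH]; simpl; intros H; [contradiction|].
  destruct H as [<- | H]; [apply Rmax_l|].
  eapply Rle_trans; [apply IH, H | apply Rmax_r].
Qed.

Lemma fold_min_ge (f : nat * nat -> R) l init m :
  (forall p, In p l -> m <= f p) -> m <= init ->
  m <= fold_right (fun p acc => Rmin (f p) acc) init l.
Proof.
  induction l as [|a l IH]; simpl; intros H Hinit; [exact Hinit|].
  apply Rmin_glb; auto.
Qed.

Lemma fold_min_le (f : nat * nat -> R) l init p :
  In p l -> fold_right (fun p acc => Rmin (f p) acc) init l <= f p.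
Proof.
  induction l as [|a l IH]; simpl; intros H; [contradiction|].
  destruct H as [<- | H]; [apply Rmin_l|].
  eapply Rle_trans; [apply Rmin_r | apply IH, H].
Qed.

(* The maximal coordinate 1 is attained at columns 1 and n/2 + 1 = 2t+2. *)
Lemma maxDelta_Cq n t q : n = (4 * t + 2)%nat -> (1 <= t)%nat -> 0 < q ->
  in_window (cos (PI / INR n)) (q * q) -> maxDelta n (Cq n q) = 1.
Proof.
  intros Hn Ht Hq Hw.
  set (f := fun p : nat * nat => Defs.Delta (Cq n q) (fst p) (snd p)).
  assert (Hbound : forall p, In p (pairs n) -> f p <= 1).
  { intros [i j] Hin. apply in_pairs in Hin.
    apply (Delta_Cq_bounds n t q i j); tauto. }
  apply Rle_antisym.
  - apply fold_max_le; [exact Hbound|].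
    apply (Hbound (1, 2)%nat), in_pairs. lia.
  - apply Rle_trans with (f (1, 2 * t + 2)%nat);
      [|apply fold_max_ge, in_pairs; lia].
    destruct (grid_step n) as [Hu Hnu]; [lia|].
    unfold f; cbn [fst snd]. rewrite Delta_Cq by lia.
    rewrite sg_opposite_parity; [| lra |].
    2: { replace (2 * t + 2)%nat with (2 * (t + 1))%nat by lia.
         rewrite Nat.even_even. discriminate. }
    replace (INR (2 * t + 2 - 1) * (PI / INR n)) with (PI / 2); [rewrite sin_PI2; lra|].
    assert (Hhalf : INR n = 2 * INR (2 * t + 2 - 1)).
    { rewrite Hn. replace (2 * t + 2 - 1)%nat with (2 * t + 1)%nat by lia.
      rewrite !plus_INR, !mult_INR. simpl INR. ring. }
    set (u := PI / INR n) in *. rewrite Hhalf in Hnu. lra.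
Qed.

(* The minimal coordinate sin u is attained at the adjacent columns 1 and 2. *)
Lemma minDelta_Cq n t q : n = (4 * t + 2)%nat -> (1 <= t)%nat -> 0 < q ->
  in_window (cos (PI / INR n)) (q * q) -> minDelta n (Cq n q) = sin (PI / INR n).
Proof.
  intros Hn Ht Hq Hw.
  set (f := fun p : nat * nat => Defs.Delta (Cq n q) (fst p) (snd p)).
  assert (Hbound : forall p, In p (pairs n) -> sin (PI / INR n) <= f p).
  { intros [i j] Hin. apply in_pairs in Hin.
    apply (Delta_Cq_bounds n t q i j); tauto. }
  assert (Hadj : f (1, 2)%nat = sin (PI / INR n)).
  { unfold f; cbn [fst snd]. rewrite Delta_Cq by lia.
    rewrite sg_opposite_parity by (simpl; lra || discriminate).
    replace (INR (2 - 1)) with 1 by (simpl; ring). rewrite !Rmult_1_l. reflexivity. }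
  apply Rle_antisym.
  - rewrite <- Hadj. apply fold_min_le, in_pairs. lia.
  - apply fold_min_ge; [exact Hbound|].
    rewrite <- Hadj. apply Rle_refl.
Qed.

Lemma E_Cq_window n t q : n = (4 * t + 2)%nat -> (1 <= t)%nat -> 0 < q ->
  in_window (cos (PI / INR n)) (q * q) -> E n (Cq n q) = 1 / sin (PI / INR n).
Proof.
  intros Hn Ht Hq Hw. unfold E.
  rewrite (maxDelta_Cq n t q), (minDelta_Cq n t q) by assumption.
  reflexivity.
Qed.

Lemma Cq_in_GrPos n q : 0 < q -> InGrPos n (rowspan n (Cq n q)).
Proof.
  intros Hq. exists (Cq n q). split; [intros v; tauto|].
  intros i j Hi Hij Hj.
  destruct (grid_step n) as [Hu Hnu]; [lia|].
  rewrite Delta_Cq by assumption.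
  apply Rmult_lt_0_compat; [apply Rmult_lt_0_compat; apply sg_pos, Hq|].
  apply (sin_grid_pos n); [assumption | assumption | lia].
Qed.

(* The first row of C^q lies in the row span of C^{q'} only if q = q':
   columns 1 and 3 force the combination to be a multiple a of the first
   row of C^{q'} with a = q'/q, and column 2 then gives a = q/q'. *)
Lemma first_row_in_span n q q' : (3 <= n)%nat -> 0 < q -> 0 < q' ->
  rowspan n (Cq n q') (fun m => fst (Cq n q m)) -> q = q'.
Proof.
  intros Hn Hq Hq' [a [b Hab]].
  destruct (grid_step n) as [Hu Hnu]; [lia|].
  set (u := PI / INR n) in *.
  assert (HN : 3 <= INR n)
    by (replace 3 with (INR 3) by (simpl; ring); apply le_INR; exact Hn).
  pose proof PI_RGT_0.
  assert (Hcos : 0 < cos u) by (apply cos_gt_0; nra).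
  assert (Hsin2 : 0 < sin (INR 2 * u)) by (apply (sin_grid_pos n); auto; lia).
  pose proof (Hab 1%nat ltac:(lia)) as Col1.
  pose proof (Hab 2%nat ltac:(lia)) as Col2.
  pose proof (Hab 3%nat ltac:(lia)) as Col3.
  rewrite !Cq_col in Col1, Col2, Col3. fold u in Col1, Col2, Col3.
  unfold sg in Col1, Col2, Col3. cbn [fst snd Nat.even] in Col1, Col2, Col3.
  replace (INR (1 - 1)) with 0 in Col1 by (simpl; ring).
  replace (INR (2 - 1)) with 1 in Col2 by (simpl; ring).
  replace (INR (3 - 1)) with (INR 2) in Col3 by reflexivity.
  rewrite Rmult_0_l, cos_0, sin_0 in Col1. rewrite Rmult_1_l in Col2.
  set (w := / q) in *. set (w' := / q') in *.
  assert (Hw : q * w = 1) by (unfold w; field; lra).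
  assert (Hw' : q' * w' = 1) by (unfold w'; field; lra).
  assert (Hw'pos : 0 < w') by (apply Rinv_0_lt_compat, Hq').
  assert (Ha : w = a * w') by lra.
  assert (Hb : b = 0).
  { rewrite Ha in Col3.
    assert (Hzero : b * (w' * sin (INR 2 * u)) = 0) by lra.
    apply Rmult_integral in Hzero as [Hzero | Hzero]; [exact Hzero | nra]. }
  subst b.
  assert (Hqa : q = a * q') by (apply (Rmult_eq_reg_r (cos u)); lra).
  assert (Ha2 : a * a = 1).
  { assert (Hprod : q * w = a * a * (q' * w')) by (rewrite Hqa, Ha; ring).
    rewrite Hw, Hw' in Hprod. lra. }
  assert (Hapos : 0 < a) by (assert (0 < w) by (apply Rinv_0_lt_compat, Hq); nra).
  assert (a = 1) by nra. subst a. lra.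
Qed.

Lemma Cq_rowspan_injective n q q' : (3 <= n)%nat -> 0 < q -> 0 < q' ->
  same_space (rowspan n (Cq n q)) (rowspan n (Cq n q')) -> q = q'.
Proof.
  intros Hn Hq Hq' Hsame. apply (first_row_in_span n); try assumption.
  apply Hsame. exists 1, 0. intros m _. ring.
Qed.

Theorem mainTheorem5 (n : nat) (Hn : (6 <= n)%nat) (Hmod : (n mod 4 = 2)%nat) :
  Cq n 1 = Cyc n /\
  (forall q : R, 0 < q -> InGrPos n (rowspan n (Cq n q))) /\
  (forall q q' : R, 0 < q -> 0 < q' -> q <> q' ->
     ~ same_space (rowspan n (Cq n q)) (rowspan n (Cq n q'))) /\
  (exists eps : R, 0 < eps /\
     forall q : R, 0 < q -> Rabs (q - 1) < eps -> E n (Cq n q) = E n (Cyc n)).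
Proof.
  pose proof (Nat.div_mod n 4 ltac:(lia)) as Hdiv. rewrite Hmod in Hdiv.
  assert (Hnt : n = (4 * (n / 4) + 2)%nat) by lia.
  assert (Ht : (1 <= n / 4)%nat) by lia.
  destruct (step_trig_bounds n Hn) as (_ & Hc & _).
  split; [apply Cq_1|]. split; [|split].
  - apply Cq_in_GrPos.
  - intros q q' Hq Hq' Hne Hsame.
    exact (Hne (Cq_rowspan_injective n q q' ltac:(lia) Hq Hq' Hsame)).
  - exists ((1 - cos (PI / INR n)) / 2). split; [lra|].
    intros q Hq Hnear. rewrite <- Cq_1.
    rewrite (E_Cq_window n (n / 4) q), (E_Cq_window n (n / 4) 1); try assumption; try lra.
    + split; lra.
    + apply in_window_near_one; assumption.
Qed.
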